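(* The non-commutative lifts of the coordinate rings of the two group functors $G^{\mathrm{over}}$ and $G^{\mathrm{under}}$ coincide with the QED propagator Hopf algebras $\mathcal{H}^{\gamma}$ and $\mathcal{H}^{e}$, respectively. That is, if $\mathcal{H}^{\gamma}_{ab}$ and $\mathcal{H}^{e}_{ab}$ denote the abelian quotients of $\mathcal{H}^{\gamma}$ and $\mathcal{H}^{e}$, then for every associative, commutative and unital $\mathbb{Q}$-algebra $A$ there are group isomorphisms, natural in $A$, $$G^{\mathrm{over}}(A)\cong \mathrm{Hom}_{Alg}(\mathcal{H}^{\gamma}_{ab},A),\qquad G^{\mathrm{under}}(A)\cong \mathrm{Hom}_{Alg}(\mathcal{H}^{e}_{ab},A),$$ where $\mathrm{Hom}_{Alg}$ denotes unital algebra homomorphisms with the convolution product; they send the series $\sum_{t\in Y} f_t x^t$ to the algebra homomorphism $t\mapsto f_t$.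
   Context: A tree means a planar binary rooted tree; its order $|t|$ is the number of its internal (trivalent) vertices. $Y_n$ is the set of trees of order $n$, $Y=\bigcup_{n\ge 0}Y_n$, $\bar Y=\bigcup_{n\ge 1}Y_n$. The only tree of order $0$ (the root tree) is denoted $\mathsf{o}$. For trees $t,s$, ''$t$ over $s$'', written $t/s$, is the tree obtained by grafting the root of $t$ on the left-most leaf of $s$; ''$t$ under $s$'', written $t\backslash s$, is the tree obtained by grafting the root of $s$ on the right-most leaf of $t$. Both operations are associative with unit $\mathsf{o}$, and are additive for the order. For an associative, commutative, unital $\mathbb{Q}$-algebra $A$, $A[[Y]]$ is the space of formal tree-expanded series $f(x)=\sum_{t\in Y}f_t\,x^t$, $f_t\in A$ ($x^t$ is just a symbol). The set $G^{\mathrm{inv}}_Y(A)=\{f\in A[[Y]] : f_{\mathsf{o}}=1\}$ is a group with unit $x^{\mathsf{o}}$ for each of the two products $(f/g)(x)=\sum_{t,s}f_tg_s\,x^{t/s}$ and $(f\backslash g)(x)=\sum_{t,s}f_tg_s\,x^{t\backslash s}$; $G^{\mathrm{over}}(A)$ and $G^{\mathrm{under}}(A)$ denote the resulting groups, respectively. The Hopf algebras $\mathcal{H}^{\gamma}$ and $\mathcal{H}^{e}$ are both, as algebras, the free associative algebra $\mathbb{Q}\langle \bar Y\rangle\cong \mathbb{Q}\langle Y\rangle/(\mathsf{o}-1)$, with coproducts the algebra morphisms given on generators $u\in\bar Y$ by $\Delta^{\mathrm{inv}}_{\gamma}(u)=\sum_{t/s=u}t\otimes s$ and $\Delta^{\mathrm{inv}}_{e}(u)=\sum_{t\backslash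 s=u}t\otimes s$ respectively (sums over $t,s\in Y$, with $\mathsf{o}=1$), and counits $\varepsilon(t)=0$ for $t\ne\mathsf{o}$. The abelian quotient of a Hopf algebra $H$ is its quotient by the ideal generated by the commutators $[H,H]$; it is a commutative Hopf algebra. A non-commutative lift of a commutative Hopf algebra $K$ is a non-commutative Hopf algebra whose abelian quotient is $K$. The coordinate ring of a group functor $G$ on commutative $\mathbb{Q}$-algebras is a commutative Hopf algebra $K$ representing it, i.e. $G(A)\cong\mathrm{Hom}_{Alg}(K,A)$ naturally as groups. *)

(* Defs.v *)
From HB Require Import structures.
From mathcomp Require Import all_boot all_order all_algebra finmap.
From mathcomp Require Import boolp.
From mathcomp Require Import monalg.

Set Implicit Arguments.
Unset Strict Implicit.
Unset Printing Implicit Defensive.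

Import GRing.Theory.
Local Open Scope ring_scope.
Local Open Scope quotient_scope.

(* [Leaf] is the root tree, the unit of [over] and [under]. *)
Inductive tree := Leaf | Node of tree & tree.

Fixpoint tree_code (t : tree) : GenTree.tree unit :=
  match t with
  | Leaf => GenTree.Leaf tt
  | Node l r => GenTree.Node 0 [:: tree_code l; tree_code r]
  end.

Fixpoint tree_decode (c : GenTree.tree unit) : option tree :=
  match c with
  | GenTree.Leaf _ => Some Leaf
  | GenTree.Node _ [:: l; r] =>
      match tree_decode l, tree_decode r with
      | Some l', Some r' => Some (Node l' r')
      | _, _ => None
      end
  | _ => None
  end.

Lemma tree_codeK : pcancel tree_code tree_decode.
Proof. by elim=> //= l -> r ->. Qed.

HB.instance Definition _ := Countable.copy tree (pcan_type tree_codeK).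

Fixpoint tree_order (t : tree) : nat :=
  if t is Node l r then (tree_order l + tree_order r).+1 else 0%N.

Fixpoint over (t s : tree) : tree :=
  if s is Node l r then Node (over t l) r else t.

Fixpoint under (t s : tree) : tree :=
  if t is Node l r then Node l (under r s) else s.

(* The finitely many pairs [(t, s)] with [over t s = u], resp. [under t s = u],
   each listed once: see [mem_over_splits], [over_splits_uniq], etc. *)
Fixpoint over_splits (u : tree) : seq (tree * tree) :=
  (u, Leaf) ::
  if u is Node l r then [seq (p.1, Node p.2 r) | p <- over_splits l] else [::].

Fixpoint under_splits (u : tree) : seq (tree * tree) :=
  (Leaf, u) ::
  if u is Node l r then [seq (Node l p.1, p.2) | p <- under_splits r] else [::].

Lemma mem_over_splits u p : (p \in over_splits u) = (over p.1 p.2 == u).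
Proof.
elim: u p => [|l IHl r _] [t s] /=; rewrite inE.
  by apply/eqP/eqP => [[-> ->]|] //; case: s => [|s1 s2] //= ->.
apply/idP/idP => [/orP[/eqP[-> ->] //|/mapP[[t' s'] /=]]|].
  by rewrite IHl => /eqP <- [-> ->].
case: s => [|s1 s2] /= /eqP; first by move->; rewrite eqxx.
case=> tE sE; apply/orP; right; apply/mapP.
by exists (t, s1); rewrite ?IHl ?tE ?sE.
Qed.

Lemma over_splits_uniq u : uniq (over_splits u).
Proof.
elim: u => //= l IHl r _; apply/andP; split; first by apply/mapP => -[[? ?] _ []].
by rewrite map_inj_uniq // => -[? ?] [? ?] /= [-> ->].
Qed.

Lemma mem_under_splits u p : (p \in under_splits u) = (under p.1 p.2 == u).
Proof.
elim: u p => [|l _ r IHr] [t s] /=; rewrite inE.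
  by apply/eqP/eqP => [[-> ->]|] //; case: t => [|t1 t2] //= ->.
apply/idP/idP => [/orP[/eqP[-> ->] //|/mapP[[t' s'] /=]]|].
  by rewrite IHr => /eqP <- [-> ->].
case: t => [|t1 t2] /= /eqP; first by move->; rewrite eqxx.
case=> tE sE; apply/mapP.
by exists (t2, s); rewrite ?IHr ?tE ?sE.
Qed.

Lemma under_splits_uniq u : uniq (under_splits u).
Proof.
elim: u => //= l _ r IHr; apply/andP; split; first by apply/mapP => -[[? ?] _ []].
by rewrite map_inj_uniq // => -[? ?] [? ?] /= [-> ->].
Qed.

Section LinearQuotient.
Variables (R : fieldType) (W : lmodType R) (S : W -> Prop).

Inductive lspan : W -> Prop :=
| Lspan_gen x : S x -> lspan x
| Lspan0 : lspan 0
| LspanD x y : lspan x -> lspan y -> lspan (x + y)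
| LspanZ a x : lspan x -> lspan (a *: x).

Definition lspan_pred : {pred W} := fun x => `[< lspan x >].

Lemma lspanP x : reflect (lspan x) (x \in lspan_pred).
Proof. exact: asboolP. Qed.

Lemma lspan_zmod_closed : zmod_closed lspan_pred.
Proof.
split=> [|x y /lspanP xS /lspanP yS]; apply/lspanP; first exact: Lspan0.
by rewrite -scaleN1r; apply: LspanD => //; apply: LspanZ.
Qed.

HB.instance Definition _ :=
  GRing.isZmodClosed.Build W lspan_pred lspan_zmod_closed.

Definition lquot : Type := Quotient.quot lspan_pred.

HB.instance Definition _ := GRing.Zmodule.on lquot.

Definition lpi (x : W) : lquot := \pi_(Quotient.quot lspan_pred) x.
Definition lrepr (x : lquot) : W := repr (x : Quotient.quot lspan_pred).

Lemma lreprK x : lpi (lrepr x) = x.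
Proof. by rewrite /lpi /lrepr reprK. Qed.

Lemma lpi_eqP x y : lpi x = lpi y <-> lspan (x - y).
Proof.
split=> [xy|xy].
  by apply/lspanP; rewrite Quotient.idealrBE; apply/eqP.
by apply/eqP; rewrite -Quotient.idealrBE; apply/lspanP.
Qed.

Lemma lpiB : {morph lpi : x y / x - y}.
Proof. by move=> x y; rewrite /lpi !piE. Qed.
HB.instance Definition _ := GRing.isZmodMorphism.Build W lquot lpi lpiB.

Definition lquot_scale (a : R) (x : lquot) : lquot := lpi (a *: lrepr x).

Lemma lquot_scaleE a x : lquot_scale a (lpi x) = lpi (a *: x).
Proof.
apply/lpi_eqP; rewrite -scalerBr; apply: LspanZ.
by apply/lpi_eqP; rewrite lreprK.
Qed.

Fact lquot_scaleA a b x :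
  lquot_scale a (lquot_scale b x) = lquot_scale (a * b) x.
Proof. by rewrite -[x]lreprK !lquot_scaleE scalerA. Qed.
Fact lquot_scale1 : left_id 1 lquot_scale.
Proof. by move=> x; rewrite -[x]lreprK !lquot_scaleE scale1r. Qed.
Fact lquot_scaleDr : right_distributive lquot_scale +%R.
Proof.
move=> a x y; rewrite -[x]lreprK -[y]lreprK -raddfD !lquot_scaleE -raddfD.
by rewrite scalerDr.
Qed.
Fact lquot_scaleDl x : {morph lquot_scale^~ x : a b / a + b}.
Proof.
by move=> a b; rewrite -[x]lreprK !lquot_scaleE -raddfD scalerDl.
Qed.
HB.instance Definition _ := GRing.Zmodule_isLmodule.Build R lquot
  lquot_scaleA lquot_scale1 lquot_scaleDr lquot_scaleDl.

Lemma lpiZ : scalable lpi.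
Proof. by move=> a x; rewrite -lquot_scaleE. Qed.
HB.instance Definition _ := GRing.isScalable.Build R W lquot *:%R lpi lpiZ.

(* Only meaningful for [f] linear and vanishing on [S]: see [lquot_liftE]. *)
Definition lquot_lift (U : lmodType R) (f : W -> U) (x : lquot) : U :=
  f (lrepr x).

Section Lift.
Variables (U : lmodType R) (f : W -> U).
Hypotheses (fL : linear f) (fS : forall x, S x -> f x = 0).

Lemma lspan_kill x : lspan x -> f x = 0.
Proof.
have f0 : f 0 = 0 by have := fL (-1) 0 0; rewrite !scaleN1r !addNr.
elim=> // [y z _ fy _ fz|a y _ fy].
  by have := fL 1 y z; rewrite !scale1r fy fz addr0.
by have := fL a y 0; rewrite !addr0 fy f0 scaler0 addr0.
Qed.

Lemma lquot_liftE x : lquot_lift f (lpi x) = f x.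
Proof.
have /lpi_eqP/lspan_kill : lpi (lrepr (lpi x)) = lpi x by rewrite lreprK.
rewrite -[_ - x]addrC -scaleN1r fL scaleN1r addrC => /eqP.
by rewrite subr_eq0 => /eqP.
Qed.

Lemma lquot_lift_linear : linear (lquot_lift f).
Proof.
move=> a x y; rewrite -[x]lreprK -[y]lreprK -linearP !lquot_liftE.
exact: fL.
Qed.

End Lift.
End LinearQuotient.

Section LinearExtension.
Variables (R : fieldType) (K : choiceType) (U : lmodType R) (g : K -> U).

Definition lext (x : {malg R[K]}) : U := \sum_(k <- msupp x) x@_k *: g k.

Lemma lextEw (d : {fset K}) x : (msupp x `<=` d)%fset ->
  lext x = \sum_(k <- d) x@_k *: g k.
Proof.
move=> le; rewrite /lext (big_fset_incl _ le) //= => k _ /mcoeff_outdom ->.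
by rewrite scale0r.
Qed.

Lemma lextU c k : lext << c *g k >> = c *: g k.
Proof. by rewrite (lextEw msuppU_le) big_seq_fset1 mcoeffUU. Qed.

Lemma lext_linear : linear lext.
Proof.
move=> a x y; pose d := (msupp x `|` msupp y `|` msupp (a *: x + y))%fset.
rewrite !(@lextEw d); try by apply/fsubsetP => k kd; rewrite !inE kd ?orbT.
rewrite scaler_sumr -big_split /=; apply: eq_bigr => k _.
by rewrite mcoeffD mcoeffZ scalerDl scalerA.
Qed.

End LinearExtension.

Definition bilin (R : fieldType) (V W U : lmodType R) (f : V -> W -> U) : Prop :=
  (forall w, linear (f^~ w)) /\ (forall v, linear (f v)).

Inductive tensor_rel (R : fieldType) (V W : lmodType R) :
    {malg R[(V * W)%type]} -> Prop :=
| Tensor_linl a v v' w : tensor_rel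
    (<< (a *: v + v', w) >> - (a *: << (v, w) >> + << (v', w) >>))
| Tensor_linr a v w w' : tensor_rel
    (<< (v, a *: w + w') >> - (a *: << (v, w) >> + << (v, w') >>)).

Definition tensor (R : fieldType) (V W : lmodType R) : Type :=
  lquot (@tensor_rel R V W).

HB.instance Definition _ (R : fieldType) (V W : lmodType R) :=
  GRing.Lmodule.on (tensor V W).

HB.lock Definition tens (R : fieldType) (V W : lmodType R) (v : V) (w : W) :
  tensor V W := lpi (@tensor_rel R V W) << (v, w) >>.

(* Only meaningful for [f] bilinear: see [tliftE]. *)
HB.lock Definition tlift (R : fieldType) (V W U : lmodType R)
    (f : V -> W -> U) (x : tensor V W) : U :=
  lquot_lift (lext (fun p : V * W => f p.1 p.2)) x.

Arguments tens {R V W} v w.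
Arguments tlift {R V W U} f x.

Section Tensor.
Variables (R : fieldType) (V W : lmodType R).

Lemma tens_bilin : bilin (@tens R V W).
Proof.
split=> [w a v v'|v a w w']; rewrite tens.unlock.
  apply: etrans (linearP (lpi (@tensor_rel R V W)) a << (v, w) >> << (v', w) >>).
  by apply/lpi_eqP/Lspan_gen/Tensor_linl.
apply: etrans (linearP (lpi (@tensor_rel R V W)) a << (v, w) >> << (v, w') >>).
by apply/lpi_eqP/Lspan_gen/Tensor_linr.
Qed.

Lemma tens_ind (P : tensor V W -> Prop) :
  (forall v w, P (tens v w)) -> (forall x y, P x -> P y -> P (x + y)) ->
  forall x, P x.
Proof.
move=> Pt PD x; rewrite -[x]lreprK; move: (lrepr x) => {}x.
have [tl tr] := tens_bilin.
have t0 w : tens 0 w = 0 :> tensor V W by have := tl w (-1) 0 0; rewrite !scaleN1r !addNr.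
have P0 : P 0 by rewrite -(t0 0).
rewrite (monalgE x) (raddf_sum (lpi (@tensor_rel R V W))).
elim/big_ind: _ => // k _.
have E : x@_k *: tens k.1 k.2 = lpi (@tensor_rel R V W) << x@_k *g k >>.
  rewrite tens.unlock -surjective_pairing -lpiZ; congr (lpi _ _); apply/malgP => k'.
  by rewrite mcoeffZ !mcoeffU; case: eqP; rewrite ?mulr1 ?mulr0.
apply: (eq_ind _ P _ _ E); case: k {E} => v w /=.
by have := tl w (x@_(v, w)) v 0; rewrite !addr0 t0 addr0 => <-.
Qed.

Section Lift.
Variables (U : lmodType R) (f : V -> W -> U).
Hypothesis fB : bilin f.

Let kill x : @tensor_rel R V W x -> lext (fun p => f p.1 p.2) x = 0.
Proof.
have L := lext_linear (fun p : V * W => f p.1 p.2); have [fl fr] := fB.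
pose l : {linear {malg R[(V * W)%type]} -> U} :=
  HB.pack (lext (fun p : V * W => f p.1 p.2))
    (GRing.isLinear.Build _ _ _ _ _ L).
by case=> [a v v' w|a v w w']; rewrite -[lext _]/(l : _ -> _) linearB linearP;
  rewrite /= !lextU !scale1r /= ?fl ?fr subrr.
Qed.

Lemma tliftE v w : tlift f (tens v w) = f v w.
Proof.
by rewrite tlift.unlock tens.unlock lquot_liftE ?lextU ?scale1r //; exact: lext_linear.
Qed.

Lemma tlift_linear : linear (tlift f).
Proof.
by rewrite tlift.unlock; apply: lquot_lift_linear; [exact: lext_linear|exact: kill].
Qed.

End Lift.
End Tensor.

Definition tmap (R : fieldType) (V V' W W' : lmodType R) (f : V -> V') (g : W -> W') :
    tensor V W -> tensor V' W' :=
  tlift (fun v w => tens (f v) (g w)).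

Definition tassoc (R : fieldType) (U V W : lmodType R) :
    tensor (tensor U V) W -> tensor U (tensor V W) :=
  tlift (fun x w => tlift (fun u v => tens u (tens v w)) x).

(* Since [algType] requires [1 != 0], tensor products and abelian quotients are
   only formed for algebras with an augmentation; in a Hopf algebra it is the
   counit. *)
HB.mixin Record hasAugmentation (R : fieldType) A of GRing.Algebra R A := {
  aug : A -> R;
  aug_linear : scalar aug;
  aug_monoid : GRing.monoid_morphism aug
}.

#[short(type="augAlgType")]
HB.structure Definition AugAlgebra (R : fieldType) :=
  { A of GRing.Algebra R A & hasAugmentation R A }.

Arguments aug {R A} : rename.

HB.instance Definition _ (R : fieldType) (A : augAlgType R) :=
  GRing.isLinear.Build R A R *%R (@aug R A) aug_linear.
HB.instance Definition _ (R : fieldType) (A : augAlgType R) :=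
  GRing.isMonoidMorphism.Build A R (@aug R A) aug_monoid.

Section TensorAlgebra.
Variables (R : fieldType) (A B : augAlgType R).
Local Notation T := (tensor A B).

Definition tmul_simple (a : A) (b : B) : T -> T :=
  tlift (fun a' b' => tens (a * a') (b * b')).

Definition tmul (x y : T) : T := tlift (fun a b => tmul_simple a b y) x.
Definition tone : T := tens 1 1.

Let tl := (tens_bilin A B).1.
Let tr := (tens_bilin A B).2.

Let simple_bilin a b : bilin (fun a' b' => tens (a * a') (b * b') : T).
Proof.
by split=> [w c u v|v c u w]; rewrite mulrDr -scalerAr ?tl ?tr.
Qed.

Let simpleE a b a' b' :
  tmul_simple a b (tens a' b') = tens (a * a') (b * b').
Proof. by rewrite /tmul_simple tliftE //; exact: simple_bilin. Qed.

Let simpleL a b : linear (tmul_simple a b).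
Proof. exact/tlift_linear/simple_bilin. Qed.

Let simpleD a b x y : tmul_simple a b (x + y) =
  tmul_simple a b x + tmul_simple a b y.
Proof. by have := simpleL a b 1 x y; rewrite !scale1r. Qed.

Let tmul_bilin y : bilin (fun a b => tmul_simple a b y).
Proof.
split=> [b c u v|a c u v]; elim/tens_ind: y => [a' b'|y z Ey Ez] /=.
- by rewrite !simpleE mulrDl -scalerAl tl.
- by rewrite !simpleD Ey Ez scalerDr addrACA.
- by rewrite !simpleE mulrDl -scalerAl tr.
- by rewrite !simpleD Ey Ez scalerDr addrACA.
Qed.

Let tmulL y : linear (tmul^~ y).
Proof. exact/tlift_linear/tmul_bilin. Qed.

Let tmulE a b y : tmul (tens a b) y = tmul_simple a b y.
Proof. by rewrite /tmul tliftE //; exact: tmul_bilin. Qed.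

Lemma tmul_tens a b a' b' :
  tmul (tens a b) (tens a' b') = tens (a * a') (b * b').
Proof. by rewrite tmulE simpleE. Qed.

Fact tmulDl : left_distributive tmul +%R.
Proof. by move=> x y z; have := tmulL z 1 x y; rewrite !scale1r. Qed.
Fact tmulDr : right_distributive tmul +%R.
Proof.
move=> x y z; elim/tens_ind: x => [a b|x x' E E']; first by rewrite !tmulE simpleD.
by rewrite !tmulDl E E' addrACA.
Qed.
Fact tmulA : associative tmul.
Proof.
move=> x y z; elim/tens_ind: x => [a b|x x' E E']; last by rewrite !tmulDl E E'.
elim/tens_ind: y => [a' b'|y y' E E'].
  elim/tens_ind: z => [a2 b2|z z' E E']; last by rewrite !tmulDr E E'.
  by rewrite !tmul_tens !mulrA.
by rewrite tmulDl !tmulDr tmulDl E E'.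
Qed.
Fact tmul1 : left_id tone tmul.
Proof.
by elim/tens_ind => [a b|x y E E']; rewrite ?tmulDr ?E ?E' // tmul_tens !mul1r.
Qed.
Fact tmulr1 : right_id tone tmul.
Proof.
by elim/tens_ind => [a b|x y E E']; rewrite ?tmulDl ?E ?E' // tmul_tens !mulr1.
Qed.

Let tmulZl c x y : tmul (c *: x) y = c *: tmul x y.
Proof.
have t0 : tmul 0 y = 0 by have := tmulL y (-1) 0 0; rewrite !scaleN1r !addNr.
by have := tmulL y c x 0; rewrite !addr0 t0 addr0.
Qed.

Let tmulZr c x y : tmul x (c *: y) = c *: tmul x y.
Proof.
elim/tens_ind: x => [a b|x x' E E']; last by rewrite !tmulDl scalerDr E E'.
have t0 : tmul_simple a b 0 = 0.
  by have := simpleL a b (-1) 0 0; rewrite !scaleN1r !addNr.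
by have := simpleL a b c y 0; rewrite !tmulE !addr0 t0 addr0.
Qed.

Definition taug : T -> R^o := @tlift R A B R^o (fun a b => aug a * aug b).

Let taug_bilin : @bilin R A B R^o (fun a b => aug a * aug b).
Proof.
split=> [b c u v|a c u v]; rewrite linearP /GRing.scale /=.
  by rewrite mulrDl mulrA.
by rewrite mulrDr mulrCA.
Qed.

Lemma taug_tens a b : taug (tens a b) = aug a * aug b.
Proof. by rewrite /taug tliftE //; exact: taug_bilin. Qed.

Fact taug_linear : linear taug.
Proof. exact/tlift_linear/taug_bilin. Qed.

Fact tone_neq0 : tone != 0.
Proof.
apply/eqP => /(congr1 taug); rewrite taug_tens !rmorph1 mulr1.
have := taug_linear (-1) 0 0; rewrite !scaleN1r !addNr => -> /eqP.
by rewrite oner_eq0.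
Qed.

HB.instance Definition _ := GRing.Zmodule_isNzRing.Build (tensor A B)
  tmulA tmul1 tmulr1 tmulDl tmulDr tone_neq0.

Fact tscaleAl (c : R) (x y : T) : c *: (x * y) = (c *: x) * y.
Proof. exact/esym/tmulZl. Qed.
HB.instance Definition _ := GRing.Lmodule_isLalgebra.Build R (tensor A B) tscaleAl.

Fact tscaleAr (c : R) (x y : T) : c *: (x * y) = x * (c *: y).
Proof. exact/esym/tmulZr. Qed.
HB.instance Definition _ := GRing.Lalgebra_isAlgebra.Build R (tensor A B) tscaleAr.

Fact taug_monoid : GRing.monoid_morphism (taug : T -> R).
Proof.
split; first by rewrite [taug 1]taug_tens !rmorph1 mulr1.
move=> x y; have D u v : taug (u + v) = taug u + taug v.
  by have := taug_linear 1 u v; rewrite !scale1r.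
elim/tens_ind: x => [a b|x x' E E']; last by rewrite mulrDl !D E E' mulrDl.
elim/tens_ind: y => [a' b'|y y' E E']; last by rewrite mulrDr !D E E' mulrDr.
by rewrite [_ * _ in LHS]tmul_tens !taug_tens !rmorphM mulrACA.
Qed.
HB.instance Definition _ :=
  hasAugmentation.Build R (tensor A B) taug_linear taug_monoid.

Lemma tens_mul (a a' : A) (b b' : B) :
  tens a b * tens a' b' = tens (a * a') (b * b').
Proof. exact: tmul_tens. Qed.

End TensorAlgebra.

Section TensorMap.
Variables (R : fieldType) (A A' B B' : augAlgType R).
Variables (f : {lrmorphism A -> A'}) (g : {lrmorphism B -> B'}).

Let fg_bilin : bilin (fun a b => tens (f a) (g b)).
Proof.
have [tl tr] := tens_bilin A' B'.
by split=> [w c u v|v c u w]; rewrite linearP ?tl ?tr.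
Qed.

Lemma tmap_tens a b : tmap f g (tens a b) = tens (f a) (g b).
Proof. by rewrite /tmap tliftE //; exact: fg_bilin. Qed.

Fact tmap_linear : linear (tmap f g).
Proof. exact/tlift_linear/fg_bilin. Qed.
HB.instance Definition _ :=
  GRing.isLinear.Build R (tensor A B) (tensor A' B') *:%R (tmap f g) tmap_linear.

Fact tmap_monoid : GRing.monoid_morphism (tmap f g).
Proof.
split; first by rewrite [tmap _ _ _]tmap_tens !rmorph1.
move=> x y; elim/tens_ind: x => [a b|x x' E E'].
  elim/tens_ind: y => [a' b'|y y' E E'].
    by rewrite !(tens_mul, tmap_tens) !rmorphM.
  by rewrite !(mulrDr, linearD) /= E E'.
by rewrite !(mulrDl, linearD) /= E E'.
Qed.
HB.instance Definition _ := GRing.isMonoidMorphism.Build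
  (tensor A B) (tensor A' B') (tmap f g) tmap_monoid.

End TensorMap.

Section Hopf.
Variables (R : fieldType) (H : augAlgType R).

Definition is_hopf (D : {lrmorphism H -> tensor H H}) : Prop :=
  [/\ forall x, tassoc (tmap D (@idfun H) (D x)) = tmap (@idfun H) D (D x),
      forall x, tlift (fun a b => aug a *: b) (D x) = x,
      forall x, tlift (fun a b => aug b *: a) (D x) = x
    & exists S : {linear H -> H}, forall x,
        tlift (fun a b => S a * b) (D x) = aug x *: 1 /\
        tlift (fun a b => a * S b) (D x) = aug x *: 1].

End Hopf.

Section AbelianQuotient.
Variables (R : fieldType) (H : augAlgType R).

(* The linear span of [comm_rel] is the two-sided ideal generated by the
   commutators. *)
Definition comm_rel (z : H) : Prop :=
  exists a x y b : H, z = a * (x * y - y * x) * b.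

Definition abq : Type := lquot comm_rel.

HB.instance Definition _ := GRing.Lmodule.on abq.

Definition abpi : H -> abq := lpi comm_rel.
HB.instance Definition _ := GRing.Linear.on abpi.

Let ideall a x : lspan comm_rel x -> lspan comm_rel (a * x).
Proof.
elim=> {x} [x [b [y [z [c ->]]]]||x y _ xS _ yS|c x _ xS].
- by apply: Lspan_gen; exists (a * b), y, z, c; rewrite !mulrA.
- by rewrite mulr0; exact: Lspan0.
- by rewrite mulrDr; exact: LspanD.
- by rewrite -scalerAr; exact: LspanZ.
Qed.

Let idealr a x : lspan comm_rel x -> lspan comm_rel (x * a).
Proof.
elim=> {x} [x [b [y [z [c ->]]]]||x y _ xS _ yS|c x _ xS].
- by apply: Lspan_gen; exists b, y, z, (c * a); rewrite !mulrA.
- by rewrite mul0r; exact: Lspan0.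
- by rewrite mulrDl; exact: LspanD.
- by rewrite -scalerAl; exact: LspanZ.
Qed.

Definition abq_mul (x y : abq) : abq := abpi (lrepr x * lrepr y).

Let mulE x y : abq_mul (abpi x) (abpi y) = abpi (x * y).
Proof.
apply/lpi_eqP.
have xE : lspan comm_rel (lrepr (abpi x) - x) by apply/lpi_eqP; rewrite lreprK.
have yE : lspan comm_rel (lrepr (abpi y) - y) by apply/lpi_eqP; rewrite lreprK.
have := LspanD (ideall (lrepr (abpi x)) yE) (idealr y xE).
by rewrite mulrBr mulrBl addrA subrK.
Qed.

Let reprK x : abpi (lrepr x) = x. Proof. exact: lreprK. Qed.

Let elim_abq (P : abq -> Prop) : (forall x, P (abpi x)) -> forall x, P x.
Proof. by move=> Px x; rewrite -[x]reprK. Qed.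

Fact abq_mulA : associative abq_mul.
Proof.
by elim/elim_abq=> x; elim/elim_abq=> y; elim/elim_abq=> z; rewrite !mulE mulrA.
Qed.
Fact abq_mul1 : left_id (abpi 1) abq_mul.
Proof. by elim/elim_abq=> x; rewrite mulE mul1r. Qed.
Fact abq_mulr1 : right_id (abpi 1) abq_mul.
Proof. by elim/elim_abq=> x; rewrite mulE mulr1. Qed.
Fact abq_mulDl : left_distributive abq_mul +%R.
Proof.
elim/elim_abq=> x; elim/elim_abq=> y; elim/elim_abq=> z.
by rewrite -linearD !mulE -linearD mulrDl.
Qed.
Fact abq_mulDr : right_distributive abq_mul +%R.
Proof.
elim/elim_abq=> x; elim/elim_abq=> y; elim/elim_abq=> z.
by rewrite -linearD !mulE -linearD mulrDr.
Qed.

Definition abq_aug : abq -> R^o := lquot_lift (fun x : H => aug x : R^o).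

Let aug_comm x : comm_rel x -> aug x = 0.
Proof.
by move=> [a [y [z [b ->]]]]; rewrite !(rmorphM, rmorphB) /= [aug z * _]mulrC
  subrr mulr0 mul0r.
Qed.

Let aug_lin : linear (fun x : H => aug x : R^o).
Proof. by move=> a x y; rewrite linearP. Qed.

Fact abq_augE x : abq_aug (abpi x) = aug x.
Proof. by rewrite /abq_aug lquot_liftE //; exact: aug_comm. Qed.

Fact abq_one_neq0 : abpi 1 != 0.
Proof.
apply/eqP => /(congr1 abq_aug); rewrite -(linear0 abpi) !abq_augE rmorph1 raddf0.
by apply/eqP; rewrite oner_eq0.
Qed.

HB.instance Definition _ := GRing.Zmodule_isNzRing.Build abq
  abq_mulA abq_mul1 abq_mulr1 abq_mulDl abq_mulDr abq_one_neq0.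

Fact abpi_monoid : GRing.monoid_morphism abpi.
Proof. by split=> // x y; rewrite -mulE. Qed.
HB.instance Definition _ := GRing.isMonoidMorphism.Build H abq abpi abpi_monoid.

Fact abq_mulC : @commutative abq abq *%R.
Proof.
elim/elim_abq=> x; elim/elim_abq=> y; rewrite -!rmorphM; apply/lpi_eqP.
by apply: Lspan_gen; exists 1, x, y, 1; rewrite mul1r mulr1.
Qed.
HB.instance Definition _ := GRing.PzRing_hasCommutativeMul.Build abq abq_mulC.

Fact abq_scaleAl (c : R) (x y : abq) : c *: (x * y) = (c *: x) * y.
Proof.
elim/elim_abq: x => x; elim/elim_abq: y => y.
by rewrite -(rmorphM abpi) -!(linearZZ abpi) -(rmorphM abpi) scalerAl.
Qed.
HB.instance Definition _ := GRing.Lmodule_isLalgebra.Build R abq abq_scaleAl.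
HB.instance Definition _ := GRing.Lalgebra_isComAlgebra.Build R abq.

Fact abq_aug_linear : linear abq_aug.
Proof. by apply: lquot_lift_linear; [exact: aug_lin|exact: aug_comm]. Qed.
Fact abq_aug_monoid : GRing.monoid_morphism (abq_aug : abq -> R).
Proof.
split; first by rewrite [abq_aug _]abq_augE rmorph1.
by elim/elim_abq=> x; elim/elim_abq=> y; rewrite -rmorphM !abq_augE rmorphM.
Qed.
HB.instance Definition _ :=
  hasAugmentation.Build R abq abq_aug_linear abq_aug_monoid.

End AbelianQuotient.

Section AbelianCoproduct.
Variables (R : fieldType) (H : augAlgType R).
Variable D : {lrmorphism H -> tensor H H}.
Local Notation T := (tensor (abq H) (abq H)).

(* Well defined since [tensor (abq H) (abq H)] is commutative. *)
Definition ab_coprod : abq H -> T :=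
  lquot_lift (fun x : H => tmap (@abpi R H) (@abpi R H) (D x)).

Let pD : {lrmorphism H -> T} := tmap (@abpi R H) (@abpi R H) \o D.

Let T_mulC (x y : T) : x * y = y * x.
Proof.
elim/tens_ind: x => [a b|x x' E E']; last by rewrite mulrDl mulrDr E E'.
elim/tens_ind: y => [a' b'|y y' E E']; last by rewrite mulrDl mulrDr E E'.
by rewrite !tens_mul mulrC [b * _]mulrC.
Qed.

Let pD_comm x : comm_rel x -> pD x = 0.
Proof.
move=> [a [y [z [b ->]]]].
by rewrite !(rmorphM pD) (rmorphB pD) !(rmorphM pD) [pD z * _]T_mulC subrr
  mulr0 mul0r.
Qed.

Lemma ab_coprodE x :
  ab_coprod (abpi x) = tmap (@abpi R H) (@abpi R H) (D x).
Proof. by apply: lquot_liftE; [exact: (linearP pD)|exact: pD_comm]. Qed.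

Fact ab_coprod_linear : linear ab_coprod.
Proof. by apply: lquot_lift_linear; [exact: (linearP pD)|exact: pD_comm]. Qed.
HB.instance Definition _ :=
  GRing.isLinear.Build R (abq H) T *:%R ab_coprod ab_coprod_linear.

Fact ab_coprod_monoid : GRing.monoid_morphism ab_coprod.
Proof.
split=> [|x y]; first exact: etrans (ab_coprodE 1) (rmorph1 pD).
have E (z : abq H) : exists z', z = abpi z' by exists (lrepr z); exact/esym/lreprK.
have [[x' ->] [y' ->]] := (E x, E y).
by rewrite -(rmorphM (@abpi R H)) !ab_coprodE; exact: (rmorphM pD).
Qed.
HB.instance Definition _ :=
  GRing.isMonoidMorphism.Build (abq H) T ab_coprod ab_coprod_monoid.

End AbelianCoproduct.

Definition freealg (R : fieldType) (X : choiceType) : Type :=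
  {malg R[{fmonom X}]}.

Section FreeAlgebra.
Variables (R : fieldType) (X : choiceType).
Local Notation F := (freealg R X).

HB.instance Definition _ := GRing.Lalgebra.on F.

Fact freealg_scaleAr (c : R) (x y : F) : c *: (x * y) = x * (c *: y).
Proof.
have xC : (x : {malg R[{fmonom X}]}) * c%:MP = c *: (x : {malg R[{fmonom X}]}).
  rewrite malgM_def malgZ_def fgmulgU; apply: eq_bigr => k _.
  by rewrite mulm1 mulrC.
by rewrite scalerAl -[c *: y]mul_malgC mulrA; congr (_ * _); rewrite -[LHS]xC.
Qed.
HB.instance Definition _ := GRing.Lalgebra_isAlgebra.Build R F freealg_scaleAr.

Definition fgen (u : X) : F := << fmu u >>.

Definition freealg_aug (x : F) : R := x@_(@mone {fmonom X}).

Fact freealg_aug_linear : scalar freealg_aug.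
Proof. by move=> a x y; rewrite /freealg_aug mcoeffD mcoeffZ. Qed.
Fact freealg_aug_monoid : GRing.monoid_morphism freealg_aug.
Proof. by split; [exact: (rmorph1 (mcoeff (@mone {fmonom X})))|exact: (rmorphM (mcoeff (@mone {fmonom X})))]. Qed.
HB.instance Definition _ :=
  hasAugmentation.Build R F freealg_aug_linear freealg_aug_monoid.

Lemma aug_fgen u : aug (fgen u) = 0 :> R.
Proof. by rewrite /aug /= /freealg_aug /fgen mcoeffU fm1_eq1. Qed.

Section Lift.
Variables (B : algType R) (g : X -> B).

Definition free_lift : F -> B :=
  lext (fun w : {fmonom X} => \prod_(u <- (w : seq X)) g u).

Lemma free_lift_fgen u : free_lift (fgen u) = g u.
Proof. by rewrite /free_lift /fgen lextU scale1r fmU big_seq1. Qed.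

Fact free_lift_linear : linear free_lift.
Proof. exact: lext_linear. Qed.
HB.instance Definition _ :=
  GRing.isLinear.Build R F B *:%R free_lift free_lift_linear.

Fact free_lift_monoid : GRing.monoid_morphism free_lift.
Proof.
split=> [|x y]; first by rewrite /free_lift lextU scale1r fm1 big_nil.
rewrite [x * y]malgME (raddf_sum free_lift) /= {2}/free_lift /lext mulr_suml.
apply: eq_bigr => v _; rewrite (raddf_sum free_lift) /= /free_lift /lext mulr_sumr.
apply: eq_bigr => w _; rewrite -/(lext _ _) lextU fmM big_cat /=.
by rewrite -scalerAl -scalerAr scalerA.
Qed.
HB.instance Definition _ :=
  GRing.isMonoidMorphism.Build F B free_lift free_lift_monoid.

End Lift.
End FreeAlgebra.

(* The library's [comAlgType] excludes the zero algebra; see [comAlg_of]. *)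
Record comAlg (R : fieldType) := ComAlg {
  comAlg_ring : comPzRingType;
  comAlg_str : {rmorphism R -> comAlg_ring}
}.

Definition comAlg_car (R : fieldType) (A : comAlg R) : Type := comAlg_ring A.
Coercion comAlg_car : comAlg >-> Sortclass.

Section ComAlg.
Variables (R : fieldType) (A : comAlg R).

HB.instance Definition _ := GRing.ComPzRing.on (comAlg_car A).

Definition comAlg_scale (c : R) (x : A) : A := comAlg_str A c * x.

Fact comAlg_scaleA c d x :
  comAlg_scale c (comAlg_scale d x) = comAlg_scale (c * d) x.
Proof. by rewrite /comAlg_scale rmorphM mulrA. Qed.
Fact comAlg_scale1 : left_id 1 comAlg_scale.
Proof. by move=> x; rewrite /comAlg_scale rmorph1 mul1r. Qed.
Fact comAlg_scaleDr : right_distributive comAlg_scale +%R.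
Proof. by move=> c x y; rewrite /comAlg_scale mulrDr. Qed.
Fact comAlg_scaleDl x : {morph comAlg_scale^~ x : c d / c + d}.
Proof. by move=> c d; rewrite /comAlg_scale rmorphD mulrDl. Qed.
HB.instance Definition _ := GRing.Zmodule_isLmodule.Build R (comAlg_car A)
  comAlg_scaleA comAlg_scale1 comAlg_scaleDr comAlg_scaleDl.

Lemma comAlg_scaleAl c (x y : A) : c *: (x * y) = (c *: x) * y.
Proof. by rewrite /GRing.scale /= /comAlg_scale mulrA. Qed.
Lemma comAlg_scaleAr c (x y : A) : c *: (x * y) = x * (c *: y).
Proof. by rewrite mulrC comAlg_scaleAl mulrC. Qed.

End ComAlg.

Definition comAlg_of (R : fieldType) (A : comAlgType R) : comAlg R :=
  ComAlg (in_alg A).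

Section Convolution.
Variables (R : fieldType) (H : augAlgType R) (A : comAlg R).

Definition Hom_Alg : Type := {lrmorphism H -> A}.

Section Mul.
Variables f g : Hom_Alg.

Definition hom_tens : tensor H H -> A := tlift (fun a b => f a * g b).

Let fg_bilin : bilin (fun a b => f a * g b : A).
Proof.
split=> [b c u v|a c u v]; rewrite linearP.
  by rewrite mulrDl comAlg_scaleAl.
by rewrite mulrDr comAlg_scaleAr.
Qed.

Let htE a b : hom_tens (tens a b) = f a * g b.
Proof. by rewrite /hom_tens tliftE //; exact: fg_bilin. Qed.

Fact hom_tens_linear : linear hom_tens.
Proof. exact/tlift_linear/fg_bilin. Qed.
HB.instance Definition _ :=
  GRing.isLinear.Build R (tensor H H) A *:%R hom_tens hom_tens_linear.

Fact hom_tens_monoid : GRing.monoid_morphism hom_tens.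
Proof.
split; first by rewrite [hom_tens _]htE !rmorph1 mulr1.
move=> x y; elim/tens_ind: x => [a b|x x' E E'].
  elim/tens_ind: y => [a' b'|y y' E E'].
    by rewrite tens_mul !htE !rmorphM mulrACA.
  by rewrite mulrDr !linearD /= E E' mulrDr.
by rewrite mulrDl !linearD /= E E' mulrDl.
Qed.
HB.instance Definition _ :=
  GRing.isMonoidMorphism.Build (tensor H H) A hom_tens hom_tens_monoid.

End Mul.

(* The convolution product [m_A \o (f (x) g) \o D]. *)
Definition conv (D : {lrmorphism H -> tensor H H}) (f g : Hom_Alg) : Hom_Alg :=
  hom_tens f g \o D.

Definition conv_one_fun (x : H) : A := comAlg_str A (aug x).

Fact conv_one_linear : linear conv_one_fun.
Proof. by move=> c x y; rewrite /conv_one_fun linearP rmorphD rmorphM. Qed.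
HB.instance Definition _ :=
  GRing.isLinear.Build R H A *:%R conv_one_fun conv_one_linear.

Fact conv_one_monoid : GRing.monoid_morphism conv_one_fun.
Proof.
by split=> [|x y]; rewrite /conv_one_fun ?rmorph1 // !rmorphM.
Qed.
HB.instance Definition _ :=
  GRing.isMonoidMorphism.Build H A conv_one_fun conv_one_monoid.

Definition conv_one : Hom_Alg := conv_one_fun.

Lemma Hom_Alg_ext (f g : Hom_Alg) : f =1 g -> f = g.
Proof.
case: f g => [f cf] [g cg] /= /funext fg; case: g / fg cg => cg.
congr GRing.LRMorphism.Pack; case: cf cg => [[a1] [a2] [a3]] [[b1] [b2] [b3]].
by rewrite (Prop_irrelevance a1 b1) (Prop_irrelevance a2 b2)
  (Prop_irrelevance a3 b3).
Qed.

End Convolution.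

Definition is_group (T : Type) (mul : T -> T -> T) (one : T) : Prop :=
  [/\ associative mul, left_id one mul, right_id one mul
    & forall x, exists y, mul y x = one /\ mul x y = one].

Definition group_iso (S T : Type) (mulS : S -> S -> S) (oneS : S)
    (mulT : T -> T -> T) (oneT : T) (f : S -> T) : Prop :=
  [/\ is_group mulS oneS, is_group mulT oneT, bijective f
    & {morph f : x y / mulS x y >-> mulT x y}].

Section Series.
Variable A : comPzRingType.

Definition series : Type := tree -> A.

Definition over_prod (f g : series) : series :=
  fun u => \sum_(p <- over_splits u) f p.1 * g p.2.

Definition under_prod (f g : series) : series :=
  fun u => \sum_(p <- under_splits u) f p.1 * g p.2.

Definition series_one : series := fun u => (u == Leaf)%:R.

Definition Ginv : Type := {f : series | f Leaf = 1}.

Fact over_prod_inv (f g : Ginv) : over_prod (sval f) (sval g) Leaf = 1.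
Proof. by rewrite /over_prod big_seq1 /= (svalP f) (svalP g) mulr1. Qed.
Fact under_prod_inv (f g : Ginv) : under_prod (sval f) (sval g) Leaf = 1.
Proof. by rewrite /under_prod big_seq1 /= (svalP f) (svalP g) mulr1. Qed.
Fact series_one_inv : series_one Leaf = 1.
Proof. by rewrite /series_one eqxx. Qed.

Definition Gover_mul (f g : Ginv) : Ginv := exist _ _ (over_prod_inv f g).
Definition Gunder_mul (f g : Ginv) : Ginv := exist _ _ (under_prod_inv f g).
Definition Ginv_one : Ginv := exist _ _ series_one_inv.

End Series.

Section SeriesMap.
Variables (A B : comPzRingType) (h : {rmorphism A -> B}).

Fact Ginv_map_inv (f : Ginv A) : (h \o sval f) Leaf = 1.
Proof. by rewrite /= (svalP f) rmorph1. Qed.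

Definition Ginv_map (f : Ginv A) : Ginv B := exist _ _ (Ginv_map_inv f).

End SeriesMap.

Definition Ybar : Type := {t : tree | (0 < tree_order t)%N}.
HB.instance Definition _ := Choice.on Ybar.

Definition Hqed : augAlgType rat := freealg rat Ybar.

Definition gen (t : tree) : Hqed := oapp (@fgen rat Ybar) 1 (insub t).

Lemma gen_Leaf : gen Leaf = 1.
Proof. by rewrite /gen insubF. Qed.

Lemma aug_gen t : aug (gen t) = (t == Leaf)%:R :> rat.
Proof.
case: t => [|l r]; first by rewrite gen_Leaf rmorph1.
by rewrite /gen insubT /= aug_fgen.
Qed.

Definition coprod_gamma_gen (u : Ybar) : tensor Hqed Hqed :=
  \sum_(p <- over_splits (val u)) tens (gen p.1) (gen p.2).

Definition coprod_e_gen (u : Ybar) : tensor Hqed Hqed :=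
  \sum_(p <- under_splits (val u)) tens (gen p.1) (gen p.2).

Definition coprod_gamma : {lrmorphism Hqed -> tensor Hqed Hqed} :=
  free_lift coprod_gamma_gen.

Definition coprod_e : {lrmorphism Hqed -> tensor Hqed Hqed} :=
  free_lift coprod_e_gen.

Definition noncommutative_lift (H : augAlgType rat)
    (D : {lrmorphism H -> tensor H H}) : Prop :=
  [/\ is_hopf D, exists x y : H, x * y != y * x & is_hopf (ab_coprod D)].

(* [(K, D)] is the coordinate ring of the group functor
   [A |-> (Ginv A, mul A, Ginv_one A)], by isomorphisms sending [f] to the
   algebra morphism with values [f t] on [i t]. *)
Definition represents (K : augAlgType rat) (D : {lrmorphism K -> tensor K K})
    (i : tree -> K)
    (mul : forall A : comAlg rat, Ginv A -> Ginv A -> Ginv A) : Prop :=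
  exists Phi : forall A : comAlg rat, Ginv A -> Hom_Alg K A,
  [/\ forall A : comAlg rat,
        group_iso (mul A) (@Ginv_one A) (conv D) (conv_one K A) (Phi A),
      forall (A B : comAlg rat) (h : {rmorphism A -> B}), scalable h ->
        forall f : Ginv A, Phi B (Ginv_map h f) =1 h \o Phi A f
    & forall (A : comAlg rat) (f : Ginv A) (t : tree),
        Phi A f (i t) = sval f t].

(* Main.v *)
(* The products "over" and "under" are associative, unital and additive for the
   order of trees, and nothing else about them is used. Associativity makes the
   coproducts coassociative and the products of series associative; since the
   order is additive, a series with constant term 1 is inverted by recursion on
   the order of trees. The antipode extends the inverse of the series [t |-> t],
   with coefficients in the algebra itself, to an antimorphism. The commutative
   case follows from the same argument, the generators of the abelian quotient
   satisfying the same formulas. Finally, an algebra morphism from the abelian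
   quotient to [A] is determined by arbitrary values on the generators, i.e. by
   a series, and convolution of morphisms is the product of series. *)
From HB Require Import structures.
From mathcomp Require Import all_boot all_order all_algebra finmap.
From mathcomp Require Import boolp monalg.
Require Import Defs.

Set Implicit Arguments.
Unset Strict Implicit.
Unset Printing Implicit Defensive.

Import GRing.Theory.
Local Open Scope ring_scope.

(** * Tree products with finitely many factorisations *)

Record splitting (op : tree -> tree -> tree)
    (spl : tree -> seq (tree * tree)) : Prop := Splitting {
  splitA : associative op;
  split0t : left_id Leaf op;
  splitt0 : right_id Leaf op;
  split_order : forall t s,
    tree_order (op t s) = (tree_order t + tree_order s)%N;
  mem_split : forall u p, (p \in spl u) = (op p.1 p.2 == u);
  split_uniq : forall u, uniq (spl u)
}.

Lemma over_splitting : splitting over over_splits.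
Proof.
split; [| |by []| |exact: mem_over_splits|exact: over_splits_uniq].
- by move=> t s; elim=> //= l <-.
- by elim=> //= l -> r _.
- by move=> t; elim=> /= [|l -> r _]; rewrite ?addn0 // addnS addnA.
Qed.

Lemma under_splitting : splitting under under_splits.
Proof.
split; [|by []| | |exact: mem_under_splits|exact: under_splits_uniq].
- by move=> t s w; elim: t => //= l _ r ->.
- by elim=> //= l _ r ->.
- by move=> t s; elim: t => //= l _ r ->; rewrite addSn addnA.
Qed.

Lemma tree_order_eq0 t : (tree_order t == 0%N) = (t == Leaf).
Proof. by case: t. Qed.

Section Splitting.
Variables (op : tree -> tree -> tree) (spl : tree -> seq (tree * tree)).
Hypothesis splP : splitting op spl.

(** Both sides sum over the triples of trees with product [u], bracketed to the left and to the
    right. By associativity the two duplicate-free lists of triples are permutations of each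
    other. *)
Lemma split_coassoc (V : nmodType) (F : tree -> tree -> tree -> V) u :
  \sum_(p <- spl u) \sum_(q <- spl p.1) F q.1 q.2 p.2 =
  \sum_(p <- spl u) \sum_(q <- spl p.2) F p.1 q.1 q.2.
Proof.
have memE := mem_split splP.
pose G (x : tree * tree * tree) := F x.1.1 x.1.2 x.2.
transitivity (\sum_(x <- [seq (q, p.2) | p <- spl u, q <- spl p.1]) G x).
  by rewrite big_allpairs_dep.
transitivity (\sum_(x <- [seq (p.1, q.1, q.2) | p <- spl u, q <- spl p.2]) G x);
  last by rewrite big_allpairs_dep.
apply: perm_big; apply: uniq_perm.
(* No triple occurs twice: the outer pair is recovered from it by multiplying the two factors of the
   component that was split. *)
- apply: allpairs_uniq_dep => [|p _|]; try exact: split_uniq splP _.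
  move=> x y /allpairsPdep[p [q [_ + ->]]] /allpairsPdep[p' [q' [_ + ->]]].
  case: p q p' q' => [t s] [x1 x2] [t' s'] [y1 y2]; rewrite !memE /=.
  by move=> /eqP <- /eqP <- [-> -> ->].
- apply: allpairs_uniq_dep => [|p _|]; try exact: split_uniq splP _.
  move=> x y /allpairsPdep[p [q [_ + ->]]] /allpairsPdep[p' [q' [_ + ->]]].
  case: p q p' q' => [t s] [x1 x2] [t' s'] [y1 y2]; rewrite !memE /=.
  by move=> /eqP <- /eqP <- [-> -> ->].
move=> [[x y] z]; apply/allpairsPdep/allpairsPdep => -[[t s] [[t' s']]].
  rewrite !memE /= => -[/eqP + /eqP + [-> -> ->]] => <- <-.
  by exists (t', op s' s), (s', s); rewrite !memE /= (splitA splP) !eqxx.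
rewrite !memE /= => -[/eqP + /eqP + [-> -> ->]] => <- <-.
by exists (op t t', s'), (t, t'); rewrite !memE /= (splitA splP) !eqxx.
Qed.

(** Additivity of the order makes [(u, Leaf)] the only splitting with first component [u]. Isolating
    its term makes the equations of a left inverse triangular. *)
Lemma big_split_unitr (V : nmodType) (F : tree -> tree -> V) u :
  \sum_(p <- spl u) F p.1 p.2 =
  F u Leaf + \sum_(p <- spl u | p.1 != u) F p.1 p.2.
Proof.
have uS : (u, Leaf) \in spl u by rewrite (mem_split splP) /= (splitt0 splP).
rewrite (bigD1_seq _ uS (split_uniq splP u)) /=; congr (_ + _).
rewrite big_seq_cond [RHS]big_seq_cond; apply: eq_bigl => -[t s] /=.
rewrite (mem_split splP) /= xpair_eqE.
case: (eqVneq (op t s) u) => //= tsu; rewrite negb_and.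
have [tu /=|//] := eqVneq t u; have := split_order splP t s.
rewrite tsu tu => /eqP; rewrite -{1}[tree_order u]addn0 eqn_add2l eq_sym.
by rewrite tree_order_eq0 => ->.
Qed.

(** This descent bounds the recursion that defines inverse series. *)
Lemma split_order_lt u p : p \in spl u -> p.1 != u ->
  (tree_order p.1 < tree_order u)%N.
Proof.
rewrite (mem_split splP) => /eqP <-; rewrite (split_order splP) => pu.
rewrite -[ltnLHS]addn0 ltn_add2l lt0n tree_order_eq0.
by apply: contraNneq pu => ->; rewrite (splitt0 splP).
Qed.

Lemma split_Leaf : spl Leaf = [:: (Leaf, Leaf)].
Proof.
apply: perm_small_eq => //; apply: uniq_perm => // [|[t s]].
  exact: split_uniq splP _.
rewrite (mem_split splP) inE /= -tree_order_eq0 (split_order splP) addn_eq0.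
by rewrite !tree_order_eq0 xpair_eqE.
Qed.

(** * The convolution monoid of series and its invertible elements *)

Section SeriesConvolution.
Variable B : pzRingType.
Implicit Types f g h : tree -> B.

(** [B] may be non-commutative: the antipode comes from inverting a series with coefficients in the
    Hopf algebra itself. *)
Definition sconv f g : tree -> B := fun u => \sum_(p <- spl u) f p.1 * g p.2.

Definition sunit : tree -> B := fun u => (u == Leaf)%:R.

Lemma sconvA f g h : sconv f (sconv g h) =1 sconv (sconv f g) h.
Proof.
move=> u; rewrite /sconv; under eq_bigr do rewrite big_distrr /=.
rewrite -(split_coassoc (fun x y z => f x * (g y * h z))).
by apply: eq_bigr => p _; rewrite big_distrl; apply: eq_bigr => q _; rewrite mulrA.
Qed.

Lemma sconvr1 f : sconv f sunit =1 f.
Proof.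
move=> u; rewrite /sconv (big_split_unitr (fun x y => f x * sunit y)).
rewrite /sunit eqxx mulr1 big_seq_cond big1 ?addr0 // => -[t s] /andP[/=].
rewrite (mem_split splP) /= => /eqP <- +; have [->|] := eqVneq s Leaf.
  by rewrite (splitt0 splP) eqxx.
by rewrite mulr0.
Qed.

Lemma sconv1r f : sconv sunit f =1 f.
Proof.
move=> u; have uS : (Leaf, u) \in spl u by rewrite (mem_split splP) /= (split0t splP).
rewrite /sconv (bigD1_seq _ uS (split_uniq splP u)) /=.
rewrite /sunit eqxx mul1r big_seq_cond big1 ?addr0 // => -[t s] /andP[/=].
rewrite (mem_split splP) /= => /eqP <-; have [->|] := eqVneq t Leaf; rewrite ?mul0r //.
by rewrite (split0t splP) eqxx.
Qed.

Lemma sconv_Leaf f g : sconv f g Leaf = f Leaf * g Leaf.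
Proof. by rewrite /sconv split_Leaf big_seq1. Qed.

Lemma eq_sconv f f' g g' : f =1 f' -> g =1 g' -> sconv f g =1 sconv f' g'.
Proof. by move=> ff gg u; apply: eq_bigr => p _; rewrite ff gg. Qed.

(* [n] is fuel: the value at [u] does not depend on [n > tree_order u]. *)
Fixpoint slinv_rec f (n : nat) (u : tree) : B :=
  if n is n'.+1 then
    sunit u - \sum_(p <- spl u | p.1 != u) slinv_rec f n' p.1 * f p.2
  else 0.

Lemma slinv_recE f n m u : (tree_order u < n)%N -> (tree_order u < m)%N ->
  slinv_rec f n u = slinv_rec f m u.
Proof.
elim: n m u => [|n IHn] [|m] u //=; rewrite !ltnS => un um.
congr (_ - _); rewrite big_seq_cond [RHS]big_seq_cond; apply: eq_bigr => p.
case/andP=> pS pN; have pu := split_order_lt pS pN.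
by congr (_ * _); apply: IHn; exact: leq_trans pu _.
Qed.

(** Since [f Leaf = 1], the equation at [u] expresses [g u] through values of [g] at trees of
    smaller order. *)
Lemma slinv_ex f : f Leaf = 1 -> exists2 g, g Leaf = 1 & sconv g f =1 sunit.
Proof.
move=> f1; pose g u := slinv_rec f (tree_order u).+1 u.
have gE : sconv g f =1 sunit.
  move=> u; rewrite /sconv (big_split_unitr (fun x y => g x * f y)) f1 mulr1.
  rewrite [g u]/= -addrA [- _ + _]addrC -[RHS]addr0; congr (_ + _).
  apply/eqP; rewrite subr_eq0 big_seq_cond [eqbRHS]big_seq_cond; apply/eqP.
  apply: eq_bigr => p /andP[pS pN]; congr (_ * _).
  (* The recursive call at [p.1] has fuel [tree_order u], whereas [g p.1] has fuel
     [(tree_order p.1).+1]; both exceed the order of [p.1]. *)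
  by apply: slinv_recE => //; exact: split_order_lt.
by exists g => //; have := gE Leaf; rewrite sconv_Leaf f1 mulr1 /sunit eqxx.
Qed.

(* A left inverse [g] of [f] has itself a left inverse, which must be [f]. *)
Lemma sinv_ex f : f Leaf = 1 ->
  exists g, [/\ g Leaf = 1, sconv g f =1 sunit & sconv f g =1 sunit].
Proof.
move=> /slinv_ex[g g1 gf]; have [h h1 hg] := slinv_ex g1.
have hf : h =1 f.
  move=> u; rewrite -[LHS]sconvr1 -[RHS]sconv1r -(eq_sconv (frefl h) gf).
  by rewrite -(eq_sconv hg (frefl f)) sconvA.
by exists g; split=> // u; rewrite -hg; exact/esym/eq_sconv.
Qed.

End SeriesConvolution.
End Splitting.

Arguments sunit : clear implicits.

(** * Linear calculus in tensor products *)

Section TensorSums.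
Variables (R : fieldType) (V W : lmodType R).

Section Lift.
Variables (U : lmodType R) (f : V -> W -> U).
Hypothesis fB : bilin f.

Lemma tliftD : {morph tlift f : x y / x + y}.
Proof. by move=> x y; have := tlift_linear fB 1 x y; rewrite !scale1r. Qed.

Lemma tlift0 : tlift f 0 = 0.
Proof. by have := tlift_linear fB (-1) 0 0; rewrite !scaleN1r !addNr. Qed.

Lemma tliftZ c : {morph tlift f : x / c *: x}.
Proof. by move=> x; have := tlift_linear fB c x 0; rewrite tlift0 !addr0. Qed.

Lemma tlift_sum I r (P : pred I) (F : I -> tensor V W) :
  tlift f (\sum_(i <- r | P i) F i) = \sum_(i <- r | P i) tlift f (F i).
Proof. exact: (big_morph _ tliftD tlift0). Qed.

End Lift.

Lemma tensDl v v' (w : W) : tens (v + v') w = tens v w + tens v' w :> tensor V W.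
Proof. by have := (tens_bilin V W).1 w 1 v v'; rewrite !scale1r. Qed.

Lemma tensDr (v : V) w w' : tens v (w + w') = tens v w + tens v w' :> tensor V W.
Proof. by have := (tens_bilin V W).2 v 1 w w'; rewrite !scale1r. Qed.

Lemma tens0l (w : W) : tens 0 w = 0 :> tensor V W.
Proof. by have := (tens_bilin V W).1 w (-1) 0 0; rewrite !scaleN1r !addNr. Qed.

Lemma tens0r (v : V) : tens v 0 = 0 :> tensor V W.
Proof. by have := (tens_bilin V W).2 v (-1) 0 0; rewrite !scaleN1r !addNr. Qed.

Lemma tens_suml I r (P : pred I) (F : I -> V) (w : W) :
  tens (\sum_(i <- r | P i) F i) w = \sum_(i <- r | P i) tens (F i) w :> tensor V W.
Proof.
exact: (big_morph (fun v => tens v w : tensor V W)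
  (fun v v' => tensDl v v' w) (tens0l w)).
Qed.

Lemma tens_sumr I r (P : pred I) (F : I -> W) (v : V) :
  tens v (\sum_(i <- r | P i) F i) = \sum_(i <- r | P i) tens v (F i) :> tensor V W.
Proof.
exact: (big_morph (fun w => tens v w : tensor V W) (tensDr v) (tens0r v)).
Qed.

End TensorSums.

Section TensorAssoc.
Variable R : fieldType.

Section Linear.
Variables U V W : lmodType R.

Let assoc_in_bilin (w : W) :
  bilin (fun (u : U) (v : V) => tens u (tens v w) : tensor U (tensor V W)).
Proof.
have [tl tr] := tens_bilin U (tensor V W); have [tl' tr'] := tens_bilin V W.
by split=> [v c u u'|u c v v']; rewrite ?tl ?tl' ?tr.
Qed.

(** Bilinearity is what allows the outer [tlift] of [tassoc] to be computed. Linearity in [w], which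
    the inner lift carries as a parameter, is reduced to simple tensors [x]. *)
Lemma tassoc_bilin : bilin (fun (x : tensor U V) (w : W) =>
  tlift (fun u v => tens u (tens v w) : tensor U (tensor V W)) x).
Proof.
split=> [w|x c w w']; first exact: tlift_linear.
elim/tens_ind: x => [u v|x y Ex Ey].
  rewrite !tliftE // (tens_bilin V W).2; exact: (tens_bilin U (tensor V W)).2.
by rewrite !(tliftD (assoc_in_bilin _)) Ex Ey scalerDr addrACA.
Qed.

Lemma tassocE (u : U) (v : V) (w : W) :
  tassoc (tens (tens u v) w) = tens u (tens v w).
Proof. by rewrite /tassoc (tliftE tassoc_bilin) (tliftE (assoc_in_bilin w)). Qed.

Lemma tassocD : {morph @tassoc R U V W : x y / x + y}.
Proof. exact: tliftD tassoc_bilin. Qed.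

Lemma tassocZ c : {morph @tassoc R U V W : x / c *: x}.
Proof. exact: tliftZ tassoc_bilin c. Qed.

Lemma tassoc_sum I r (P : pred I) (F : I -> tensor (tensor U V) W) :
  tassoc (\sum_(i <- r | P i) F i) = \sum_(i <- r | P i) tassoc (F i).
Proof. exact: tlift_sum tassoc_bilin _ _ _ _. Qed.

End Linear.

Lemma tassocM (A B C : augAlgType R) : {morph @tassoc R A B C : x y / x * y}.
Proof.
have D := @tassocD A B C => x y.
elim/tens_ind: x => [x c|x x' E E']; last by rewrite mulrDl !D E E' mulrDl.
elim/tens_ind: y => [y c'|y y' E E']; last by rewrite mulrDr !D E E' mulrDr.
rewrite tens_mul; elim/tens_ind: x => [a b|x x' E E'].
  elim/tens_ind: y => [a' b'|y y' E E'].
    by rewrite tens_mul !tassocE !tens_mul.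
  by rewrite mulrDr !tensDl !D E E' mulrDr.
by rewrite mulrDl !tensDl !D E E' mulrDl.
Qed.

End TensorAssoc.

Section TensorMap.
Variables (R : fieldType) (A A' B B' : augAlgType R).
Variables (f : {lrmorphism A -> A'}) (g : {lrmorphism B -> B'}).

Lemma tmapZ c : {morph tmap f g : x / c *: x}.
Proof. exact: linearZZ. Qed.

Lemma tmapD : {morph tmap f g : x y / x + y}.
Proof. exact: linearD. Qed.

Lemma tmapM : {morph tmap f g : x y / x * y}.
Proof. exact: rmorphM. Qed.

Lemma tmap_sum I r (P : pred I) (F : I -> tensor A B) :
  tmap f g (\sum_(i <- r | P i) F i) = \sum_(i <- r | P i) tmap f g (F i).
Proof. exact: linear_sum. Qed.

End TensorMap.

(** * Counit and antipode laws on products *)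

Section AugTensor.
Variables (R : fieldType) (H : augAlgType R).

Lemma counitl_bilin : bilin (fun a b : H => aug a *: b).
Proof.
split=> [w c u v|v c u w]; first by rewrite linearP scalerDl scalerA.
by rewrite scalerDr !scalerA mulrC.
Qed.

Lemma counitr_bilin : bilin (fun a b : H => aug b *: a).
Proof.
split=> [w c u v|v c u w]; first by rewrite scalerDr !scalerA mulrC.
by rewrite linearP scalerDl scalerA.
Qed.

Lemma antipodel_bilin (S : {linear H -> H}) : bilin (fun a b : H => S a * b).
Proof.
split=> [w c u v|v c u w]; first by rewrite linearP mulrDl scalerAl.
by rewrite mulrDr scalerAr.
Qed.

Lemma antipoder_bilin (S : {linear H -> H}) : bilin (fun a b : H => a * S b).
Proof.
split=> [w c u v|v c u w]; first by rewrite mulrDl scalerAl.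
by rewrite linearP mulrDr scalerAr.
Qed.

Lemma counitlM : {morph tlift (fun a b : H => aug a *: b) : x y / x * y}.
Proof.
have [B D] := (counitl_bilin, tliftD counitl_bilin) => x y.
elim/tens_ind: x => [a b|x x' E E']; last by rewrite mulrDl !D E E' mulrDl.
elim/tens_ind: y => [a' b'|y y' E E']; last by rewrite mulrDr !D E E' mulrDr.
by rewrite tens_mul !tliftE // rmorphM -scalerAl -scalerAr scalerA.
Qed.

Lemma counitrM : {morph tlift (fun a b : H => aug b *: a) : x y / x * y}.
Proof.
have [B D] := (counitr_bilin, tliftD counitr_bilin) => x y.
elim/tens_ind: x => [a b|x x' E E']; last by rewrite mulrDl !D E E' mulrDl.
elim/tens_ind: y => [a' b'|y y' E E']; last by rewrite mulrDr !D E E' mulrDr.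
by rewrite tens_mul !tliftE // rmorphM -scalerAl -scalerAr scalerA.
Qed.

Section Antipode.
Variable S : {linear H -> H}.
Hypothesis SM : forall x y, S (x * y) = S y * S x.

(** As [S] reverses products, the contribution of [x] is enclosed between the two legs of [y], where
    it collapses to the scalar [c]. *)
Lemma antipodelM c (x y : tensor H H) :
  tlift (fun a b => S a * b) x = c *: 1 ->
  tlift (fun a b => S a * b) (x * y) = c *: tlift (fun a b => S a * b) y.
Proof.
have [B LD] := (antipodel_bilin S, tliftD (antipodel_bilin S)) => Ex.
elim/tens_ind: y => [a b|u v E E']; last by rewrite mulrDr !LD E E' scalerDr.
transitivity (S a * tlift (fun a b => S a * b) x * b); last first.
  by rewrite Ex tliftE // -scalerAr mulr1 scalerAl.
elim/tens_ind: x {Ex} => [a' b'|u v E E']; last first.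
  by rewrite mulrDl !LD E E' mulrDr mulrDl.
by rewrite tens_mul !tliftE // SM !mulrA.
Qed.

(** Mirror image of [antipodelM]: here the second factor [y] is the enclosed one. *)
Lemma antipoderM c (x y : tensor H H) :
  tlift (fun a b => a * S b) y = c *: 1 ->
  tlift (fun a b => a * S b) (x * y) = c *: tlift (fun a b => a * S b) x.
Proof.
have [B LD] := (antipoder_bilin S, tliftD (antipoder_bilin S)) => Ey.
elim/tens_ind: x => [a b|u v E E']; last by rewrite mulrDl !LD E E' scalerDr.
transitivity (a * tlift (fun a b => a * S b) y * S b); last first.
  by rewrite Ey tliftE // -scalerAr mulr1 scalerAl.
elim/tens_ind: y {Ey} => [a' b'|u v E E']; last first.
  by rewrite mulrDr !LD E E' mulrDr mulrDl.
by rewrite tens_mul !tliftE // SM !mulrA.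
Qed.

End Antipode.
End AugTensor.

(** * Induction and antimorphisms on free algebras *)

Section FreeAlgebra.
Variables (R : fieldType) (X : choiceType).
Local Notation F := (freealg R X).

(** An element is a linear combination of words, and a word is a product of letters. *)
Lemma freealg_ind (P : F -> Prop) :
  (forall c x, P x -> P (c *: x)) -> (forall x y, P x -> P y -> P (x + y)) ->
  P 1 -> (forall u, P (fgen R u)) -> (forall x y, P x -> P y -> P (x * y)) ->
  forall x, P x.
Proof.
move=> PZ PD P1 Pg PM x; rewrite [x]monalgE; elim/big_ind: _ => // [|k _].
  by rewrite -(scale0r (1 : F)); exact: PZ.
have -> : << x@_k *g k >> = x@_k *: (<< k >> : F).
  by apply/malgP => k'; rewrite mcoeffZ !mcoeffU mulrnAr mulr1.
apply: PZ; case: k => s; elim: s => [|u s IHs]; first by rewrite -fmoneE.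
have -> : (<< FMonom (u :: s) >> : F) = fgen R u * (<< FMonom s >> : F).
  rewrite /fgen malgM_def fgmulUU mulr1; congr << _ *g _ >>.
  by apply/val_inj; rewrite /= fmM fmU.
exact: PM.
Qed.

Section AntiLift.
Variables (B : algType R) (g : X -> B).

(** The algebra antimorphism extending [g], obtained by reading each word backwards. *)
Definition free_antilift : F -> B :=
  lext (fun w : {fmonom X} => \prod_(u <- rev (w : seq X)) g u).

HB.instance Definition _ :=
  GRing.isLinear.Build R F B *:%R free_antilift (lext_linear _).

Lemma free_antilift_fgen u : free_antilift (fgen R u) = g u.
Proof. by rewrite /free_antilift lextU scale1r fmU big_seq1. Qed.

Lemma free_antilift1 : free_antilift 1 = 1.
Proof. by rewrite /free_antilift lextU scale1r fm1 big_nil. Qed.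

Lemma free_antiliftM x y :
  free_antilift (x * y) = free_antilift y * free_antilift x.
Proof.
rewrite [x * y]malgME (raddf_sum free_antilift) /=.
rewrite {2 3}/free_antilift /lext mulr_sumr; apply: eq_bigr => v _.
rewrite (raddf_sum free_antilift) /= mulr_suml; apply: eq_bigr => w _.
rewrite /free_antilift lextU fmM rev_cat big_cat /=.
by rewrite -scalerAl -scalerAr scalerA mulrC.
Qed.

End AntiLift.
End FreeAlgebra.

(** * Hopf axioms for a coproduct given by splittings *)

(** Generation as an algebra, phrased as an induction principle; the unit is reached as [g Leaf],
    which equals [1] in every use. *)
Definition generated (R : fieldType) (H : algType R) (g : tree -> H) : Prop :=
  forall P : H -> Prop,
    (forall c x, P x -> P (c *: x)) -> (forall x y, P x -> P y -> P (x + y)) ->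
    (forall t, P (g t)) -> (forall x y, P x -> P y -> P (x * y)) ->
    forall x, P x.

Section HopfOfSplitting.
Variables (op : tree -> tree -> tree) (spl : tree -> seq (tree * tree)).
Hypothesis splP : splitting op spl.
Variables (R : fieldType) (H : augAlgType R) (g : tree -> H).
Hypotheses (gP : generated g) (g_Leaf : g Leaf = 1).
Hypothesis aug_g : forall t, aug (g t) = (t == Leaf)%:R :> R.
Variable D : {lrmorphism H -> tensor H H}.
Hypothesis D_g : forall t, D (g t) = \sum_(p <- spl t) tens (g p.1) (g p.2).

(** Both sides are multiplicative and linear in [x], so generators suffice, and there the identity
    is [split_coassoc]. *)
Lemma split_coprod_coassoc x :
  tassoc (tmap D (@idfun H) (D x)) = tmap (@idfun H) D (D x).
Proof.
apply: (gP (P := fun x =>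
    tassoc (tmap D (@idfun H) (D x)) = tmap (@idfun H) D (D x)))
  => {x} [c x E|x y E E'|t|x y E E'].
- by rewrite (linearZZ D) !tmapZ (@tassocZ R H H H) E.
- by rewrite (raddfD D) !tmapD (@tassocD R H H H) E E'.
- rewrite D_g !tmap_sum (@tassoc_sum R H H H) /=.
  under eq_bigr do rewrite tmap_tens D_g tens_suml (@tassoc_sum R H H H).
  under [RHS]eq_bigr do rewrite tmap_tens D_g tens_sumr.
  rewrite -(split_coassoc splP (fun t s w => tens (g t) (tens (g s) (g w)))).
  by apply: eq_bigr => p _; apply: eq_bigr => q _; rewrite tassocE.
- by rewrite (rmorphM D) !tmapM (@tassocM R H H H) E E'.
Qed.

Lemma split_coprod_counitl x : tlift (fun a b : H => aug a *: b) (D x) = x.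
Proof.
have [B LD] := (counitl_bilin H, tliftD (counitl_bilin H)).
apply: (gP (P := fun x => tlift (fun a b : H => aug a *: b) (D x) = x))
  => {x} [c x E|x y E E'|t|x y E E'].
- by rewrite (linearZZ D) (tliftZ B) E.
- by rewrite (raddfD D) LD E E'.
(* On generators the counit law is the left unit law of convolution, applied to the series [g]. *)
- rewrite D_g (tlift_sum B) -[RHS](sconv1r splP g t).
  by apply: eq_bigr => p _; rewrite tliftE // aug_g /sunit scaler_nat mulr_natl.
- by rewrite (rmorphM D) counitlM E E'.
Qed.

Lemma split_coprod_counitr x : tlift (fun a b : H => aug b *: a) (D x) = x.
Proof.
have [B LD] := (counitr_bilin H, tliftD (counitr_bilin H)).
apply: (gP (P := fun x => tlift (fun a b : H => aug b *: a) (D x) = x))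
  => {x} [c x E|x y E E'|t|x y E E'].
- by rewrite (linearZZ D) (tliftZ B) E.
- by rewrite (raddfD D) LD E E'.
- rewrite D_g (tlift_sum B) -[RHS](sconvr1 splP g t).
  by apply: eq_bigr => p _; rewrite tliftE // aug_g /sunit scaler_nat mulr_natr.
- by rewrite (rmorphM D) counitrM E E'.
Qed.

(** Met in two ways: by reversing words in the free algebra, and by the universal property in the
    abelian quotient, where morphisms are antimorphisms. *)
Hypothesis antilift : forall s : tree -> H, s Leaf = 1 ->
  exists2 S : {linear H -> H},
    {morph S : x y / x * y >-> y * x} & forall t, S (g t) = s t.

(* The antipode extends the convolution inverse of [g]. *)
Lemma split_hopf : is_hopf D.
Proof.
split; [exact: split_coprod_coassoc|exact: split_coprod_counitl|
        exact: split_coprod_counitr|].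
have [s [s1 sg gs]] := sinv_ex splP g_Leaf; have [S SM S_g] := antilift s1.
exists S => x; have [Bl Br] := (antipodel_bilin S, antipoder_bilin S).
apply: (gP (P := fun x => tlift (fun a b => S a * b) (D x) = aug x *: 1 /\
                          tlift (fun a b => a * S b) (D x) = aug x *: 1))
  => {x} [c x [E E']|x y [E1 E1'] [E2 E2']|t|x y [E1 E1'] [E2 E2']].
- by rewrite (linearZZ D) (tliftZ Bl) (tliftZ Br) E E' !scalerA linearZ.
- by rewrite (raddfD D) (tliftD Bl) (tliftD Br) E1 E1' E2 E2' !(raddfD (@aug R H)) /= !scalerDl.
- rewrite D_g (tlift_sum Bl) (tlift_sum Br) aug_g scaler_nat.
  split; [transitivity (sconv spl s g t)|transitivity (sconv spl g s t)] => //.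
    by apply: eq_bigr => p _; rewrite tliftE // S_g.
  by apply: eq_bigr => p _; rewrite tliftE // S_g.
- rewrite (rmorphM D) (antipodelM SM _ E1) (antipoderM SM _ E2') E2 E1' !scalerA.
  by rewrite (rmorphM (@aug R H)) mulrC.
Qed.

End HopfOfSplitting.

(** * Universal properties over commutative algebras *)

Section ComAlgLift.
Variables (R : fieldType) (X : choiceType) (A : comAlg R) (g : X -> A).
Local Notation F := (freealg R X).

(** Counterpart of [free_lift] for a commutative target that may be the zero algebra. *)
Definition free_clift : F -> A :=
  lext (fun w : {fmonom X} => \prod_(u <- (w : seq X)) g u).

HB.instance Definition _ :=
  GRing.isLinear.Build R F A *:%R free_clift (lext_linear _).

Fact free_clift_monoid : GRing.monoid_morphism free_clift.
Proof.
split=> [|x y]; first by rewrite /free_clift lextU scale1r fm1 big_nil.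
rewrite [x * y]malgME (raddf_sum free_clift) /= {2}/free_clift /lext mulr_suml.
apply: eq_bigr => v _; rewrite (raddf_sum free_clift) /= mulr_sumr.
apply: eq_bigr => w _; rewrite /free_clift lextU fmM big_cat /=.
by rewrite -comAlg_scaleAl -comAlg_scaleAr scalerA.
Qed.
HB.instance Definition _ :=
  GRing.isMonoidMorphism.Build F A free_clift free_clift_monoid.

Lemma free_clift_fgen u : free_clift (fgen R u) = g u.
Proof. by rewrite /free_clift lextU scale1r fmU big_seq1. Qed.

End ComAlgLift.

Section AbelianLift.
Variables (R : fieldType) (H : augAlgType R).
Local Notation pi := (@abpi R H).

Lemma abq_ind (P : abq H -> Prop) : (forall x, P (pi x)) -> forall x, P x.
Proof. by move=> Ppi x; rewrite -[x]lreprK; exact: Ppi. Qed.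

Variables (A : comAlg R) (f : Hom_Alg H A).

(** The factorisation of [f] through the abelian quotient; [f] kills commutators because [A] is
    commutative. *)
Definition abq_lift : abq H -> A := lquot_lift f.

Let f_linear : linear f. Proof. exact: linearP. Qed.

Let f_comm x : comm_rel x -> f x = 0.
Proof.
move=> [a [y [z [b ->]]]]; rewrite !(rmorphM f) (rmorphB f) !(rmorphM f).
by rewrite [f z * _]mulrC subrr mulr0 mul0r.
Qed.

Lemma abq_liftE x : abq_lift (pi x) = f x.
Proof. exact: lquot_liftE f_linear f_comm x. Qed.

HB.instance Definition _ := GRing.isLinear.Build R (abq H) A *:%R abq_lift
  (lquot_lift_linear f_linear f_comm).

Fact abq_lift_monoid : GRing.monoid_morphism abq_lift.
Proof.
split=> [|x y]; first by rewrite [LHS](abq_liftE 1) rmorph1.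
elim/abq_ind: x => x; elim/abq_ind: y => y.
by rewrite -(rmorphM pi) !abq_liftE (rmorphM f).
Qed.
HB.instance Definition _ :=
  GRing.isMonoidMorphism.Build (abq H) A abq_lift abq_lift_monoid.

End AbelianLift.

(** The extension is given as data rather than as mere existence, so that projecting it defines a
    map from series to morphisms. *)
Definition comAlg_lifting (R : fieldType) (H : augAlgType R) (g : tree -> H) :=
  forall (A : comAlg R) (s : tree -> A), s Leaf = 1 ->
    {phi : Hom_Alg H A | forall t, phi (g t) = s t}.

(** * Passage to the abelian quotient *)

Section AbelianTransfer.
Variables (R : fieldType) (H : augAlgType R) (g : tree -> H).
Local Notation K := (abq H).
Local Notation pi := (@abpi R H).

Lemma generated_abq : generated g -> generated (fun t => pi (g t)).
Proof.
move=> gP P PZ PD Pg PM; elim/abq_ind; apply: gP => //.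
- by move=> c x Px; rewrite (linearZZ pi); exact: PZ.
- by move=> x y Px Py; rewrite (raddfD pi); exact: PD.
- by move=> x y Px Py; rewrite (rmorphM pi); exact: PM.
Qed.

Lemma lifting_abq : comAlg_lifting g -> comAlg_lifting (fun t => pi (g t)).
Proof.
move=> lift A s s1; have [phi phiE] := lift A s s1.
by exists (abq_lift phi) => t; rewrite [LHS]abq_liftE.
Qed.

(** The quotient is itself a commutative algebra, so the universal property applies with the
    quotient as target, and the resulting morphism is also an antimorphism. *)
Lemma antilift_abq : comAlg_lifting g -> forall s : tree -> K, s Leaf = 1 ->
  exists2 S : {linear K -> K},
    {morph S : x y / x * y >-> y * x} & forall t, S (pi (g t)) = s t.
Proof.
move=> lift s s1; have [phi phiE] := lifting_abq lift (A := comAlg_of K) s1.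
(* In [comAlg_of K] a scalar acts as multiplication by its image under [in_alg]; this has to be
   identified with the scaling of [K]. *)
have phiL : linear (phi : K -> K).
  move=> c x y; rewrite [LHS](linearP phi); congr (_ + _).
  exact: (mulr_algl c (phi x : K)).
pose S : {linear K -> K} := HB.pack (phi : K -> K)
  (GRing.isLinear.Build _ _ _ _ _ phiL).
exists S => [x y|t]; last exact: phiE.
by rewrite mulrC; exact: (rmorphM phi).
Qed.

Lemma ab_coprod_gen spl (D : {lrmorphism H -> tensor H H}) :
  (forall t,
     D (g t) = \sum_(p <- spl t : seq (tree * tree)) tens (g p.1) (g p.2)) ->
  forall t,
    ab_coprod D (pi (g t)) = \sum_(p <- spl t) tens (pi (g p.1)) (pi (g p.2)).
Proof.
move=> D_g t; rewrite ab_coprodE D_g tmap_sum.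
by apply: eq_bigr => p _; rewrite tmap_tens.
Qed.

End AbelianTransfer.

(** * Representability of the groups of series *)

Section Representation.
Variables (op : tree -> tree -> tree) (spl : tree -> seq (tree * tree)).
Hypothesis splP : splitting op spl.
Variables (H : augAlgType rat) (g : tree -> H).
Hypotheses (gP : generated g) (g_Leaf : g Leaf = 1).
Hypothesis aug_g : forall t, aug (g t) = (t == Leaf)%:R :> rat.
Variable D : {lrmorphism H -> tensor H H}.
Hypothesis D_g : forall t, D (g t) = \sum_(p <- spl t) tens (g p.1) (g p.2).
Hypothesis lift : comAlg_lifting g.
Variable mul : forall A : comAlg rat, Ginv A -> Ginv A -> Ginv A.
Hypothesis mulE : forall (A : comAlg rat) (f h : Ginv A),
  sval (mul f h) =1 sconv spl (sval f) (sval h).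

Lemma Ginv_ext (A : comPzRingType) (f h : Ginv A) : sval f =1 sval h -> f = h.
Proof.
case: f h => [f f1] [h h1] /= /funext fh; case: h / fh h1 => h1.
by congr exist; exact: Prop_irrelevance.
Qed.

Section Fixed.
Variable A : comAlg rat.

Lemma Ginv_group : is_group (@mul A) (@Ginv_one A).
Proof.
split=> [f h k|f|f|f].
- apply: Ginv_ext => t; rewrite !mulE.
  by rewrite (eq_sconv spl (frefl _) (mulE h k)) (sconvA splP)
    (eq_sconv spl (mulE f h) (frefl _)).
- by apply: Ginv_ext => t; rewrite mulE; exact: (sconv1r splP (sval f) t).
- by apply: Ginv_ext => t; rewrite mulE; exact: (sconvr1 splP (sval f) t).
have [h [h1 hf fh]] := sinv_ex splP (svalP f).
by exists (exist _ h h1); split; apply: Ginv_ext => t; rewrite mulE ?hf ?fh.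
Qed.

Lemma Hom_Alg_generated (f h : Hom_Alg H A) :
  (forall t, f (g t) = h (g t)) -> f = h.
Proof.
move=> fh; apply: Hom_Alg_ext; apply: gP => // [c x E|x y E E'|x y E E'].
- by rewrite (linearZZ f) (linearZZ h); congr (_ *: _).
- by rewrite (raddfD f) (raddfD h); congr (_ + _).
- by rewrite (rmorphM f) (rmorphM h); congr (_ * _).
Qed.

(** The coproduct of a generator runs over the splittings of its tree, so convolution of morphisms
    restricts to convolution of series. *)
Lemma conv_gen (f h : Hom_Alg H A) t :
  conv D f h (g t) = sconv spl (f \o g) (h \o g) t.
Proof.
have B : bilin (fun a b => f a * h b : A).
  split=> [b c u v|a c u v]; first by rewrite (linearP f) mulrDl comAlg_scaleAl.
  by rewrite (linearP h) mulrDr comAlg_scaleAr.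
rewrite [LHS]/(hom_tens f h (D (g t))) D_g /hom_tens (tlift_sum B).
by apply: eq_bigr => p _; exact: tliftE B _ _.
Qed.

Definition hom_of_series (f : Ginv A) : Hom_Alg H A := sval (lift (svalP f)).

Lemma hom_of_seriesE (f : Ginv A) t : hom_of_series f (g t) = sval f t.
Proof. exact: (svalP (lift (svalP f))). Qed.

Lemma hom_of_series_bij : bijective hom_of_series.
Proof.
have inv1 (phi : Hom_Alg H A) : phi (g Leaf) = 1 by rewrite g_Leaf rmorph1.
(* The inverse map reads off the values on the generators; [g Leaf = 1] gives the constant term. *)
exists (fun phi : Hom_Alg H A => exist (fun f : series A => f Leaf = 1) (phi \o g) (inv1 phi)).
  by move=> f; apply: Ginv_ext => t; exact: hom_of_seriesE.
by move=> phi; apply: Hom_Alg_generated => t; rewrite hom_of_seriesE.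
Qed.

Lemma hom_of_seriesM :
  {morph hom_of_series : f h / mul f h >-> conv D f h}.
Proof.
move=> f h; apply: Hom_Alg_generated => t; rewrite hom_of_seriesE conv_gen mulE.
by apply: eq_sconv => u; rewrite -hom_of_seriesE.
Qed.

Lemma hom_of_series1 : hom_of_series (Ginv_one A) = conv_one H A.
Proof.
apply: Hom_Alg_generated => t; rewrite hom_of_seriesE.
by rewrite [RHS]/(comAlg_str A (aug (g t))) aug_g; exact/esym/rmorph_nat.
Qed.

(** The group laws for convolution of morphisms are transported from those of series along the
    multiplicative bijection. *)
Lemma hom_of_series_iso : group_iso (@mul A) (@Ginv_one A) (conv D)
  (conv_one H A) hom_of_series.
Proof.
split; [exact: Ginv_group| |exact: hom_of_series_bij|exact: hom_of_seriesM].
have [mA m1 mr1 mV] := Ginv_group; have [k kK Kk] := hom_of_series_bij.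
split=> [f h l|f|f|f]; last 1 first.
- have [h [hf fh]] := mV (k f); exists (hom_of_series h).
  by rewrite -[f]Kk -!hom_of_seriesM hf fh hom_of_series1.
- by rewrite -[f]Kk -[h]Kk -[l]Kk -!hom_of_seriesM mA.
- by rewrite -[f]Kk -hom_of_series1 -hom_of_seriesM m1.
- by rewrite -[f]Kk -hom_of_series1 -hom_of_seriesM mr1.
Qed.

End Fixed.

Lemma splitting_represents : represents D g mul.
Proof.
exists hom_of_series; split=> [A|A B h hZ f|A f t].
- exact: hom_of_series_iso.
(* Naturality: [F] and [h \o G] are algebra morphisms, the latter because [h] is scalable, and they
   agree on the generators. *)
- set F := hom_of_series _; set G := hom_of_series f.
  apply: gP => [c x E|x y E E'|t|x y E E'] /=.
  + by rewrite (linearZZ F) (linearZZ G) hZ; congr (_ *: _).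
  + by rewrite (raddfD F) (raddfD G) (raddfD h); congr (_ + _).
  + by rewrite !hom_of_seriesE.
  + by rewrite (rmorphM F) (rmorphM G) (rmorphM h); congr (_ * _).
- exact: hom_of_seriesE.
Qed.

End Representation.

(** * The free algebra on trees and its two coproducts *)

Lemma gen_val (u : Ybar) : gen (val u) = fgen rat u.
Proof. by rewrite /gen valK. Qed.

(** Reduces a statement on all trees to the unit, which is the image of [Leaf], and the free
    generators. *)
Lemma lift_gen (T : Type) (phi : Hqed -> T) (s : tree -> T) :
  phi 1 = s Leaf -> (forall u : Ybar, phi (fgen rat u) = s (val u)) ->
  forall t, phi (gen t) = s t.
Proof.
move=> s1 sE [|l r]; first by rewrite gen_Leaf.
exact: etrans (congr1 phi (gen_val (Sub (Node l r) isT))) (sE _).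
Qed.

Lemma generated_gen : generated gen.
Proof.
move=> P PZ PD Pg PM; apply: freealg_ind => //.
  by rewrite -gen_Leaf; exact: Pg.
by move=> u; rewrite -gen_val; exact: Pg.
Qed.

Lemma antilift_gen (s : tree -> Hqed) : s Leaf = 1 ->
  exists2 S : {linear Hqed -> Hqed},
    {morph S : x y / x * y >-> y * x} & forall t, S (gen t) = s t.
Proof.
move=> s1; exists (free_antilift (fun u : Ybar => s (val u))).
  exact: free_antiliftM.
apply: lift_gen; first by rewrite s1; exact: free_antilift1.
exact: free_antilift_fgen.
Qed.

Lemma comAlg_lifting_gen : comAlg_lifting gen.
Proof.
move=> A s s1; exists (free_clift (fun u : Ybar => s (val u))).
apply: lift_gen; first by rewrite s1; exact: rmorph1.
exact: free_clift_fgen.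
Qed.

Lemma Hqed_noncommutative : exists x y : Hqed, x * y != y * x.
Proof.
(* Two distinct trees give two distinct words, and the coefficient of the first word separates the
   two products. *)
pose y1 : Ybar := Sub (Node Leaf Leaf) isT.
pose y2 : Ybar := Sub (Node (Node Leaf Leaf) Leaf) isT.
exists (fgen rat y1), (fgen rat y2); apply/eqP; rewrite /fgen !malgM_def !fgmulUU.
move=> /(congr1 (mcoeff (mmul (fmu y1) (fmu y2)))); rewrite mcoeffUU mcoeffU.
case: eqP => [|_ /eqP]; last by rewrite mulr0n mulr1 oner_eq0.
by move=> /(congr1 (@fmonom_val _)); rewrite !fmM !fmU.
Qed.

(** The general results are used for both [Hqed] and its abelian quotient; they differ only in how
    antimorphisms are produced. *)
Lemma splitting_lift_represents op spl
    (D : {lrmorphism Hqed -> tensor Hqed Hqed})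
    (mul : forall A : comAlg rat, Ginv A -> Ginv A -> Ginv A) :
  splitting op spl ->
  (forall u : Ybar,
     D (fgen rat u) = \sum_(p <- spl (val u)) tens (gen p.1) (gen p.2)) ->
  (forall (A : comAlg rat) (f h : Ginv A),
     sval (mul A f h) =1 sconv spl (sval f) (sval h)) ->
  noncommutative_lift D /\ represents (ab_coprod D) (fun t => abpi (gen t)) mul.
Proof.
move=> splP D_fgen mulE.
have D_gen : forall t, D (gen t) = \sum_(p <- spl t) tens (gen p.1) (gen p.2).
  apply: lift_gen D_fgen.
  by rewrite (split_Leaf splP) big_seq1 gen_Leaf; exact: rmorph1.
have ab_gen := ab_coprod_gen D_gen.
have abP := generated_abq generated_gen.
have ab_Leaf : abpi (gen Leaf) = 1 by rewrite gen_Leaf; exact: rmorph1.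
have aug_ab t : aug (abpi (gen t)) = (t == Leaf)%:R :> rat.
  by rewrite -aug_gen; exact: abq_augE.
split; last first.
  have rep := splitting_represents splP abP ab_Leaf aug_ab ab_gen.
  exact: rep (lifting_abq comAlg_lifting_gen) _ mulE.
have hopf := split_hopf splP generated_gen gen_Leaf aug_gen D_gen.
have ab_hopf := split_hopf splP abP ab_Leaf aug_ab ab_gen.
split; [exact: hopf antilift_gen|exact: Hqed_noncommutative|].
exact: ab_hopf (antilift_abq comAlg_lifting_gen).
Qed.

Theorem theorem1p5 :
  (noncommutative_lift coprod_gamma /\
   represents (ab_coprod coprod_gamma) (fun t : tree => abpi (gen t))
     (fun A : comAlg rat => @Gover_mul A)) /\
  (noncommutative_lift coprod_e /\
   represents (ab_coprod coprod_e) (fun t : tree => abpi (gen t))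
     (fun A : comAlg rat => @Gunder_mul A)).
Proof.
split.
  by apply: (splitting_lift_represents over_splitting) => // u;
    exact: free_lift_fgen.
by apply: (splitting_lift_represents under_splitting) => // u;
  exact: free_lift_fgen.
Qed.
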